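(* Let $k\geq 3$ be an odd integer, and let $X,Y\in\mathbb{Z}$ be coprime and of opposite parities. Suppose that $X^2+3Y^2=W^k$ for some integer $W>0$. Then there are coprime integers $E,F$ of opposite parities such that \[ X+Y\eta=(E+F\eta)^k \qquad\text{and}\qquad E^2+3F^2=W . \]
   Context: Here $\eta=\sqrt{-3}\in\mathbb{C}$, and the identity $X+Y\eta=(E+F\eta)^k$ is an identity in the ring $\mathbb{Z}[\eta]=\mathbb{Z}[\sqrt{-3}]\subset\mathbb{C}$. *)

(* Defs.v *)
From HB Require Import structures.
From mathcomp Require Import all_boot all_order all_algebra.
From mathcomp Require Import reals.
From mathcomp Require Import complex.

Set Implicit Arguments.
Unset Strict Implicit.
Unset Printing Implicit Defensive.

Import Order.TTheory GRing.Theory Num.Theory.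
Local Open Scope ring_scope.

Definition opposite_parity (m n : int) : bool := (2 %| m)%Z != (2 %| n)%Z.

(* [sqrtC] is the root with nonnegative imaginary part, so this is i * sqrt 3. *)
Definition etaC (R : realType) : R[i] := sqrtC (- 3).

(* Main.v *)
Require Import Defs.
From HB Require Import structures.
From mathcomp Require Import all_boot all_order all_algebra.
From mathcomp Require Import reals.
From mathcomp Require Import complex.
From mathcomp Require Import zify ring.

(** Write [eta] for a square root of [-3].  The ring [Z[eta]] does not have
    unique factorisation, so instead of splitting [X + Y eta] into primes the
    proof exhibits the root directly as a short vector of a lattice.

    Since [X] and [Y] are coprime, [Y] is invertible modulo [W ^ k], and
    [t = X / Y] satisfies [t ^ 2 = -3] modulo [W ^ k].  Reduction [eta |-> -t]
    is a ring morphism from [Z[eta]] to [Z / W ^ k] that kills [X + Y eta].  Let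
    [L] be the lattice of all [(a, b)] with [a = t b] modulo [W].  On [L] the form
    [a ^ 2 + 3 b ^ 2] is divisible by [W], and a pigeonhole argument gives a
    nonzero vector of [L] on which it is [m W] with [m < 4] ([thue_norm]).  The case
    [m = 2] is impossible modulo 4 because [W] is odd, and when [m = 3] division
    by [eta] stays inside [L] because [3] does not divide [W]
    ([coprime_norm_root3]); so [L] contains [(E, F)] with [E ^ 2 + 3 F ^ 2 = W]
    ([norm_in_lattice]).

    Now [E + F eta] reduces to a multiple of [W], hence its power
    [A + B eta = (E + F eta) ^ k] reduces to [0] modulo [W ^ k], exactly like
    [X + Y eta].  Two elements of the same norm [W ^ k] killed by the same
    reduction have a quotient in [Z[eta]] of norm 1 ([eq_norm_same_reduction]), so
    they agree up to sign, and the sign is absorbed in [E + F eta] because [k]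
    is odd. *)

Set Implicit Arguments.
Unset Strict Implicit.
Unset Printing Implicit Defensive.

Import Order.TTheory GRing.Theory Num.Theory.
Local Open Scope ring_scope.

(** * Parity *)

Lemma dvd2_sqr (X : int) : (2 %| X ^+ 2 - X)%Z.
Proof.
have [q [->|->]] : exists q : int, X = 2 * q \/ X = 2 * q + 1.
- by exists (X %/ 2)%Z; lia.
- by apply/dvdzP; exists (2 * q * q - q); ring.
- by apply/dvdzP; exists (2 * q * q + q); ring.
Qed.

Lemma opposite_parityE (X Y : int) :
  opposite_parity X Y = ~~ (2 %| X ^+ 2 + 3 * Y ^+ 2)%Z.
Proof.
have := dvd2_sqr X; have := dvd2_sqr Y; rewrite /opposite_parity.
move: (X ^+ 2) (Y ^+ 2) => x y; lia.
Qed.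

(** * Short vectors in the lattice a = t b modulo W *)

Lemma floor_sqrt (n : nat) : exists s : nat, (s * s <= n < s.+1 * s.+1)%N.
Proof.
elim: n => [|n [s /andP[sn ns]]]; first by exists 0%N.
have [ltn|gen] := ltnP n.+1 (s.+1 * s.+1); first by exists s; lia.
by exists s.+1; nia.
Qed.

(** Pigeonhole on the box [0 <= a <= s], [0 <= b <= r] with
    [s = floor (sqrt W)] and [r = floor (sqrt (W - 1))].  The box has more than
    [W] points, and taking [W - 1] for the second side makes the bound [4 W] strict
    even when [W] is a square. *)
Lemma thue_norm (W : nat) (t : int) : (0 < W)%N ->
  exists a b : int, [/\ (a != 0) || (b != 0), (W %| a - t * b)%Z
    & a ^+ 2 + 3 * b ^+ 2 < 4 * W%:Z].
Proof.
move=> W0.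
have [s /andP[sW Ws]] := floor_sqrt W.
have [r /andP[rW Wr]] := floor_sqrt W.-1.
pose h (p : 'I_s.+1 * 'I_r.+1) : int := p.1%:Z - t * p.2%:Z.
have hlt p : (`|(h p %% W)%Z|%N < W)%N.
  by rewrite -ltz_nat gez0_abs ?modz_ge0 ?ltz_pmod // -lt0n.
pose f p := Ordinal (hlt p).
have /injectivePn[p [q npq fpq]] : ~~ injectiveb f.
  apply/negP => /injectiveP /leq_card.
  rewrite card_prod !card_ord; nia.
exists (p.1%:Z - q.1%:Z), (p.2%:Z - q.2%:Z).
have bd (x y m : nat) :
    (x < m.+1)%N -> (y < m.+1)%N -> (x%:Z - y%:Z) ^+ 2 <= (m * m)%N%:Z.
  by rewrite expr2; nia.
split.
- apply: contraR npq; rewrite negb_or !negbK !subr_eq0 => /andP[e1 e2].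
  move: p q {fpq} e1 e2 => [p1 p2] [q1 q2] /= /eqP[e1] /eqP[e2].
  by apply/eqP; congr (_, _); apply: val_inj.
- have -> : p.1%:Z - q.1%:Z - t * (p.2%:Z - q.2%:Z) = h p - h q.
    by rewrite /h; ring.
  have W0' : W%:Z != 0 by rewrite -lt0n.
  have /(congr1 Posz) := congr1 val fpq; rewrite /= !gez0_abs ?modz_ge0 //.
  by move=> e; rewrite -eqz_mod_dvd; apply/eqP.
- have := bd _ _ _ (ltn_ord p.1) (ltn_ord q.1).
  have := bd _ _ _ (ltn_ord p.2) (ltn_ord q.2).
  move: (_ ^+ 2) (_ ^+ 2) => x y; lia.
Qed.

(** Coprimality costs nothing: writing [E = t F + W s], the identity
    [E ^ 2 + 3 F ^ 2 = W] divided by [W] is a Bezout relation. *)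
Lemma norm_in_lattice (W t : int) :
  0 < W -> ~~ (2 %| W)%Z -> coprimez W 3 -> (W %| t ^+ 2 + 3)%Z ->
  exists E F : int,
    [/\ coprimez E F, (W %| E - t * F)%Z & E ^+ 2 + 3 * F ^+ 2 = W].
Proof.
move=> W0 oddW cop3 Wt.
suff [E [F [EF nEF]]] : exists E F : int,
    (W %| E - t * F)%Z /\ E ^+ 2 + 3 * F ^+ 2 = W.
  exists E, F; split=> //; apply/coprimezP.
  have /dvdzP[s es] := EF; have /dvdzP[c ec] := Wt.
  exists (E * s ^+ 2, c * F + 2 * t * s + 3 * F * s ^+ 2) => /=.
  have W0' : W != 0 by lia.
  apply: (mulfI W0'); rewrite mulr1.
  have -> : W * (E * s ^+ 2 * E + (c * F + 2 * t * s + 3 * F * s ^+ 2) * F)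
          = W * s ^+ 2 * (E ^+ 2 + 3 * F ^+ 2) + (c * W) * F ^+ 2
            + 2 * t * F * (s * W) by ring.
  rewrite nEF -ec -es.
  have -> : W * s ^+ 2 * W = (s * W) ^+ 2 by ring.
  by rewrite -es -[RHS]nEF; ring.
case: W W0 oddW cop3 Wt => // W W0 oddW cop3 Wt.
have {}W0 : (0 < W)%N by lia.
have [a [b [nz ab lt4]]] := thue_norm t W0.
have /dvdzP[m em] : (W %| a ^+ 2 + 3 * b ^+ 2)%Z.
  have -> : a ^+ 2 + 3 * b ^+ 2
          = (a + t * b) * (a - t * b) + b ^+ 2 * (t ^+ 2 + 3) by ring.
  by rewrite rpredD ?dvdz_mull.
have pos : 0 < a ^+ 2 + 3 * b ^+ 2.
  have := sqr_ge0 a; have := sqr_ge0 b.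
  by case/orP: nz; rewrite -sqrf_eq0; lia.
have : m = 1 \/ m = 2 \/ m = 3 by nia.
case=> [m1|[m2|m3]].
- by exists a, b; split=> //; rewrite em m1 mul1r.
- (* a and b have the same parity, so the norm is divisible by 4 *)
  exfalso; subst m.
  have /dvdzP[c ec] : (2 %| a - b)%Z.
    by have := dvd2_sqr a; have := dvd2_sqr b; lia.
  have ea : a = b + c * 2 by lia.
  move: em; rewrite ea.
  have -> : (b + c * 2) ^+ 2 + 3 * b ^+ 2 = 4 * (b ^+ 2 + b * c + c ^+ 2).
    by ring.
  by move: (_ + _) => x; lia.
- (* a + b eta = eta (b - a' eta) with a = 3 a' *)
  subst m; have /dvdzP[a' ea] : (3 %| a)%Z.
    have : (3 %| a * a)%Z.
      by apply/dvdzP; exists (W%:Z - b ^+ 2); rewrite expr2 in em; lia.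
    have [q [r [-> rlt]]] : exists q r : int, a = 3 * q + r /\ 0 <= r < 3.
      by exists (a %/ 3)%Z, (a %% 3)%Z; lia.
    have [->|[->|->]] : r = 0 \/ r = 1 \/ r = 2 by lia.
    + by move=> _; lia.
    + have -> : (3 * q + 1) * (3 * q + 1) = 3 * (3 * q * q + 2 * q) + 1.
        by ring.
      by move: (_ + 2 * q) => x; lia.
    + have -> : (3 * q + 2) * (3 * q + 2) = 3 * (3 * q * q + 4 * q + 1) + 1.
        by ring.
      by move: (3 * q * q + 4 * q + 1) => x; lia.
  exists b, (- a'); split; last first.
    by apply: (@mulfI _ 3) => //; rewrite -em ea; ring.
  rewrite -(Gauss_dvdzr _ cop3).
  have -> : 3 * (b - t * - a') = t * (a - t * b) + b * (t ^+ 2 + 3).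
    by rewrite ea; ring.
  by rewrite rpredD ?dvdz_mull.
Qed.

(** * Powers in Z[eta] *)

(** The first conjunct is the universal form of [(E + F eta) ^ n = A + B eta]:
    at a root of [z ^ 2 + 3] it is that equation, while at an integer [z] it is
    the congruence modulo [z ^ 2 + 3] used for the reduction [eta |-> -t]. *)
Lemma powerE (E F : int) (n : nat) : exists A B : int,
  (forall (S : comNzRingType) (z : S), exists c : S,
     (E%:~R + F%:~R * z) ^+ n = A%:~R + B%:~R * z + c * (z ^+ 2 + 3))
  /\ A ^+ 2 + 3 * B ^+ 2 = (E ^+ 2 + 3 * F ^+ 2) ^+ n.
Proof.
elim: n => [|n [A [B [IH nAB]]]].
  exists 1, 0; split; last by rewrite expr0; ring.
  by move=> S z; exists 0; rewrite expr0; ring.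
exists (E * A - 3 * F * B), (E * B + F * A); split; last first.
  by rewrite [RHS]exprS -nAB; ring.
move=> S z; have [c ec] := IH S z.
exists ((E%:~R + F%:~R * z) * c + F%:~R * B%:~R).
by rewrite [LHS]exprS ec; ring.
Qed.

(** The product of [X + Y eta] with the conjugate of [A + B eta] has norm [N ^ 2]
    and [eta]-coordinate divisible by [N], so that coordinate vanishes. *)
Lemma eq_norm_same_reduction (N t X Y A B : int) : 0 < N ->
  X ^+ 2 + 3 * Y ^+ 2 = N -> A ^+ 2 + 3 * B ^+ 2 = N ->
  (N %| X - t * Y)%Z -> (N %| A - t * B)%Z ->
  (X = A /\ Y = B) \/ (X = - A /\ Y = - B).
Proof.
move=> N0 nXY nAB XY AB.
have /dvdzP[v ev] : (N %| Y * A - X * B)%Z.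
  have -> : Y * A - X * B = Y * (A - t * B) - B * (X - t * Y) by ring.
  by rewrite rpredB ?dvdz_mull.
have N0' : N != 0 by lia.
have nprod : (X * A + 3 * (Y * B)) ^+ 2 + 3 * (Y * A - X * B) ^+ 2 = N ^+ 2.
  by rewrite [RHS]expr2 -{1}nXY -nAB; ring.
have v0 : v = 0.
  have : 3 * (v ^+ 2 * N ^+ 2) <= N ^+ 2.
    rewrite -exprMn -ev -nprod; move: (sqr_ge0 (X * A + 3 * (Y * B))).
    by move: (_ ^+ 2) => x; lia.
  rewrite mulrA -[leRHS]mul1r ler_pM2r ?exprn_gt0 //.
  by clear; rewrite expr2; nia.
have eX : (X * A + 3 * (Y * B)) * A = X * N.
  have -> : (X * A + 3 * (Y * B)) * A
          = X * (A ^+ 2 + 3 * B ^+ 2) + 3 * B * (Y * A - X * B) by ring.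
  by rewrite ev v0 nAB; ring.
have eY : (X * A + 3 * (Y * B)) * B = Y * N.
  have -> : (X * A + 3 * (Y * B)) * B
          = Y * (A ^+ 2 + 3 * B ^+ 2) - A * (Y * A - X * B) by ring.
  by rewrite ev v0 nAB; ring.
have : (X * A + 3 * (Y * B)) ^+ 2 == N ^+ 2.
  by rewrite -nprod ev v0 mul0r expr0n /= mulr0 addr0.
rewrite eqf_sqr => /orP[] /eqP u; rewrite u in eX eY; [left | right].
- by split; apply: (mulfI N0'); rewrite ?eX ?eY mulrC.
- by split; apply: (mulfI N0'); rewrite mulrN -mulNr ?eX ?eY mulrC.
Qed.

(** * Extraction of the k-th root *)

(** The bound [2 <= k] matters: it makes a factor 3 of [W] occur at least twice
    in the norm, which forces [3] to divide both [X] and [Y]. *)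
Lemma coprime_norm_root3 (k : nat) (X Y W : int) : (2 <= k)%N ->
  coprimez X Y -> X ^+ 2 + 3 * Y ^+ 2 = W ^+ k -> coprimez W 3.
Proof.
move=> k2 cop nXY; apply/contraT => ncop.
have W3 : (3 %| W)%Z.
  by move: ncop; rewrite coprimezE coprime_sym prime_coprime // negbK.
have /dvdzP[w ew] : (3 ^+ 2 %| W ^+ k)%Z.
  by rewrite -(subnK k2) exprD dvdz_mull // dvdz_exp2r.
have sq3 (x : int) : (3 %| x ^+ 2)%Z -> (3 %| x)%Z.
  by rewrite !dvdzE abszX Euclid_dvdX // => /andP[].
have X3 : (3 %| X)%Z by apply: sq3; lia.
have /dvdzP[x ex] := X3.
have Y3 : (3 %| Y)%Z.
  by apply: sq3; move: nXY; rewrite ew ex exprMn; move: (x ^+ 2) => u; lia.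
have : (3 %| gcdz X Y)%Z by rewrite dvdz_gcd X3.
by rewrite (eqP cop).
Qed.

Theorem theorem2p2 (R : realType) (k : nat) (X Y W : int)
  (hk : (3 <= k)%N) (kodd : odd k)
  (copXY : coprimez X Y) (parXY : opposite_parity X Y)
  (hW : 0 < W) (hXYW : X ^+ 2 + 3 * Y ^+ 2 = W ^+ k) :
  exists E F : int,
    [/\ coprimez E F,
        opposite_parity E F,
        X%:~R + Y%:~R * etaC R = (E%:~R + F%:~R * etaC R) ^+ k
      & E ^+ 2 + 3 * F ^+ 2 = W].
Proof.
have k0 : (0 < k)%N by lia.
have WWk : (W %| W ^+ k)%Z by rewrite -(prednK k0) exprS dvdz_mulr.
have oddW : ~~ (2 %| W)%Z.
  by move: parXY; rewrite opposite_parityE hXYW; apply: contra => /dvdz_trans->.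
have copW3 := coprime_norm_root3 (ltnW hk) copXY hXYW.
have copYW : coprimez (W ^+ k) Y.
  have /coprimezP[[u v] /= uv] : coprimez (X ^+ 2) Y by rewrite coprimezXl.
  apply/coprimezP; exists (u, v - 3 * u * Y) => /=.
  by rewrite -hXYW -uv; ring.
have [t XtY] : exists t, (W ^+ k %| X - t * Y)%Z.
  have /coprimezP[[u v] /= uv] := copYW.
  exists (v * X); apply/dvdzP; exists (u * X).
  by rewrite -[X in X - _]mul1r -uv; ring.
have Wt : (W ^+ k %| t ^+ 2 + 3)%Z.
  rewrite -(Gauss_dvdzr _ (coprimezXr 2 copYW)).
  have -> : Y ^+ 2 * (t ^+ 2 + 3)
          = (X ^+ 2 + 3 * Y ^+ 2) - (X + t * Y) * (X - t * Y) by ring.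
  by rewrite hXYW rpredB ?dvdz_mull.
have [E [F [copEF EtF nEF]]] :=
  norm_in_lattice hW oddW copW3 (dvdz_trans WWk Wt).
have parEF : opposite_parity E F by rewrite opposite_parityE nEF.
have [A [B [pow nAB]]] := powerE E F k.
have AtB : (W ^+ k %| A - t * B)%Z.
  have [c] := pow int (- t); rewrite !intz => ec.
  have -> : A - t * B = (E - t * F) ^+ k - c * (t ^+ 2 + 3).
    have -> : E - t * F = E + F * - t by ring.
    by rewrite ec; ring.
  by rewrite rpredB ?dvdz_mull ?dvdz_exp2r.
have eta2 : etaC R ^+ 2 + 3 = 0 by rewrite sqrtCK addNr.
have powC : (E%:~R + F%:~R * etaC R) ^+ k = A%:~R + B%:~R * etaC R.
  by have [c ->] := pow _ (etaC R); rewrite eta2 mulr0 addr0.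
rewrite nEF in nAB.
have [[-> ->]|[-> ->]] :=
  eq_norm_same_reduction (exprn_gt0 k hW) hXYW nAB XtY AtB.
- by exists E, F.
- exists (- E), (- F); rewrite !sqrrN; split=> //.
  + by rewrite /coprimez gcdzN gcdNz.
  + by rewrite opposite_parityE !sqrrN nEF.
  + rewrite !rmorphN !mulNr -!opprD exprNn -signr_odd kodd expr1.
    by rewrite mulN1r powC.
Qed.
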